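(* For every real $d\geq 2$, $$\chi(\mathbb{H},d)\leq 5\left(\left\lceil \frac{d}{\log(4)}\right\rceil+1\right).$$
   Context: $\mathbb{H}=\{(x,y)\in\mathbb{R}^2 : y>0\}$ is the hyperbolic plane (upper half-plane model) with distance $d_{\mathbb{H}}((x,y),(x',y'))=\operatorname{arccosh}\left(1+\frac{(x-x')^2+(y-y')^2}{2yy'}\right)$. For $d>0$, $\chi(\mathbb{H},d)$ denotes the minimal number of colors needed to color all points of $\mathbb{H}$ so that any two points at hyperbolic distance exactly $d$ receive different colors. *)

(* Defs.v *)
From HB Require Import structures.
From mathcomp Require Import all_boot all_order all_algebra.
From mathcomp Require Import all_classical all_reals all_analysis.
From mathcomp Require Import ring lra.

Set Implicit Arguments.
Unset Strict Implicit.
Unset Printing Implicit Defensive.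

Import Order.TTheory GRing.Theory Num.Theory.
Import numFieldNormedType.Exports.

Local Open Scope classical_set_scope.
Local Open Scope ring_scope.

(* Meaningful for 1 <= x; see [arccosh_ge0] and [arccoshK]. *)
Definition arccosh (R : realType) (x : R) : R :=
  ln (x + Num.sqrt (x ^+ 2 - 1)).

Lemma arccosh_ge0 (R : realType) (x : R) : 1 <= x -> 0 <= arccosh x.
Proof.
move=> x1; apply: ln_ge0; apply: (le_trans x1).
by rewrite lerDl sqrtr_ge0.
Qed.

Lemma arccoshK (R : realType) (x : R) : 1 <= x ->
  (expR (arccosh x) + expR (- arccosh x)) / 2 = x.
Proof.
move=> x1; rewrite expRN /arccosh.
have s0 := sqrtr_ge0 (x ^+ 2 - 1).
have s2 : Num.sqrt (x ^+ 2 - 1) ^+ 2 = x ^+ 2 - 1 by apply: sqr_sqrtr; nra.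
move: s0 s2; set s := Num.sqrt _ => s0 s2.
have xs0 : 0 < x + s by lra.
rewrite lnK ?posrE //.
have -> : (x + s)^-1 = x - s.
  apply: (mulfI (lt0r_neq0 xs0)); rewrite divff ?lt0r_neq0 //.
  have -> : (x + s) * (x - s) = x ^+ 2 - s ^+ 2 by ring.
  by rewrite s2; ring.
by field.
Qed.

Definition Hplane (R : realType) : Type := {p : R * R | 0 < p.2}.

Definition Hdist (R : realType) (p q : Hplane R) : R :=
  let: (x, y) := sval p in
  let: (x', y') := sval q in
  arccosh (1 + ((x - x') ^+ 2 + (y - y') ^+ 2) / (2 * y * y')).

Definition Hcolorable (R : realType) (d : R) (n : nat) : Prop :=
  exists c : Hplane R -> 'I_n,
    forall p q : Hplane R, Hdist p q = d -> c p <> c q.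

(* An extended real: [+oo] when no finite number of colors suffices. Otherwise
   the infimum is attained, see [chiH_min]. *)
Definition chiH (R : realType) (d : R) : \bar R :=
  ereal_inf [set n%:R%:E | n in [set n : nat | Hcolorable d n]].

Lemma chiH_min (R : realType) (d : R) (n : nat) :
  chiH d = n%:R%:E <->
  Hcolorable d n /\ forall m : nat, Hcolorable d m -> (n <= m)%N.
Proof.
have minP k : Hcolorable d k -> (forall m, Hcolorable d m -> (k <= m)%N) ->
    chiH d = k%:R%:E.
  move=> ck kmin; apply/eqP; rewrite eq_le; apply/andP; split.
    by apply: ereal_inf_lbound; exists k.
  by apply: le_ereal_inf_tmp => _ [m cm <-]; rewrite lee_fin ler_nat kmin.
split=> [chin|[cn nmin]]; last exact: minP.
have [ex|nex] := pselect (exists k, `[< Hcolorable d k >]); last first.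
  move: chin; rewrite /chiH (_ : [set _ | _ in _] = set0) ?ereal_inf0 //.
  rewrite -subset0 => _ [k ck <-]; apply: nex; exists k.
  exact/asboolP.
case: (ex_minnP ex) => k /asboolP ck kmin.
have kmin' m : Hcolorable d m -> (k <= m)%N by move=> cm; apply/kmin/asboolP.
have := minP k ck kmin'; rewrite chin => /eqP.
by rewrite eqe eqr_nat => /eqP ->.
Qed.

(* Main.v *)
Require Import Defs.
From mathcomp Require Import all_boot all_order all_algebra.
From mathcomp Require Import all_classical all_reals all_analysis.
From mathcomp Require Import ring lra zify.

Set Implicit Arguments.
Unset Strict Implicit.
Unset Printing Implicit Defensive.

Import Order.TTheory GRing.Theory Num.Theory.
Local Open Scope ring_scope.

(** Cut the half-plane into the horizontal strips [4^k <= y < 4^(k+1)] of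
    hyperbolic height [log 4], and give the strips
    [N = ceil (d / log 4) + 1] disjoint palettes of five colors, cyclically.
    Two distinct strips with the same palette are more than
    [(N - 1) log 4 >= d] apart.  Inside the strip [k], points at distance [d]
    satisfy [4^k a <= |x - x'| < 4 * 4^k a] with [a = 2 sinh (d / 2)], so it
    suffices to color the cells of width [4^k a] cyclically with five colors. *)

(** The remainder already lies between 0 and [n], so neither the absolute value nor [inord] alters
    it. *)
Definition residue (n : nat) (k : int) : 'I_n.+1 := inord `|(k %% n.+1)%Z|%N.

Lemma residue_eq (n : nat) (k l : int) :
  residue n k = residue n l -> k = l \/ n.+1%:Z <= `|k - l|.
Proof.
have lt_n (i : int) : (`|(i %% n.+1)%Z|%N < n.+1)%N.
  by have := @ltz_pmod i n.+1 isT; have := @modz_ge0 i n.+1 isT; lia.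
move=> /(congr1 val); rewrite /= !inordK // => eq_kl.
have /eqP : (k %% n.+1)%Z = (l %% n.+1)%Z.
  by have := @modz_ge0 k n.+1 isT; have := @modz_ge0 l n.+1 isT; lia.
rewrite eqz_mod_dvd => /dvdzP[q eq_q].
have [q0|q0] := eqVneq q 0; [left|right]; first by move: eq_q; rewrite q0; lia.
by rewrite eq_q normrM; nia.
Qed.

(** Distinct floors with the same residue are at least [n + 1] apart, and the fractional parts
    change this gap by less than 1. *)
Lemma residue_floor_eq (R : realType) (n : nat) (u v : R) :
  residue n (Num.floor u) = residue n (Num.floor v) ->
  Num.floor u = Num.floor v \/ n%:R < `|u - v|.
Proof.
move=> /residue_eq[?|le_n]; [by left|right].
have [u1 u2] := (floor_le u, floorD1_gt u).
have [v1 v2] := (floor_le v, floorD1_gt v).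
have : (n.+1%:R : R) <= `|(Num.floor u)%:~R - (Num.floor v)%:~R|.
  by rewrite -[leLHS]/(n.+1%:Z%:~R) -rmorphB /= -intr_norm ler_int.
move: u1 u2 v1 v2; rewrite !rmorphD /= -natr1 => u1 u2 v1 v2.
rewrite ler_normr ltr_normr => /orP[] le_k; apply/orP; [left|right]; lra.
Qed.

Lemma floor_eq_dist (R : realType) (u v : R) :
  Num.floor u = Num.floor v -> `|u - v| < 1.
Proof.
move=> uv; have [u1 u2] := (floor_le u, floorD1_gt u).
have [v1 v2] := (floor_le v, floorD1_gt v).
by move: u1 u2 v1 v2; rewrite uv !rmorphD /= => *; rewrite ltr_norml; lra.
Qed.

(** Applying cosh removes [arccosh]; the last factor is [2 cosh d - 2], the square of
    [2 sinh (d / 2)]. *)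
Lemma Hdist_eq (R : realType) (p q : Hplane R) (d : R) : Hdist p q = d ->
  ((sval p).1 - (sval q).1) ^+ 2 + ((sval p).2 - (sval q).2) ^+ 2 =
  (sval p).2 * (sval q).2 * (expR d + expR (- d) - 2).
Proof.
case: p => [[x y] /= y0]; case: q => [[x' y'] /= y'0]; rewrite /Hdist /=.
set t := (_ / _) => dE.
have t0 : 0 <= t.
  by rewrite divr_ge0 ?addr_ge0 ?sqr_ge0 // !mulr_ge0 // ltW.
have := @arccoshK R (1 + t); rewrite dE lerDl t0 => /(_ isT) tE.
have -> : expR d + expR (- d) - 2 = 2 * t by lra.
by rewrite /t; field; rewrite !lt0r_neq0.
Qed.

(** As a quadratic in [y], the difference of the two sides of the last hypothesis has the roots
    [expR d * z] and [expR (- d) * z], so it is positive as soon as [y] exceeds both. *)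
Lemma ln_dist_le (R : realType) (d y z : R) : 0 <= d -> 0 < y -> 0 < z ->
  (y - z) ^+ 2 <= y * z * (expR d + expR (- d) - 2) -> `|ln y - ln z| <= d.
Proof.
move=> d0; wlog yz : y z / z <= y => [hw y0 z0 le_yz|y0 z0 le_yz].
  have [/hw|/ltW/hw] := leP z y; first exact.
  by rewrite distrC; apply=> //; rewrite -(opprB y) sqrrN (mulrC z).
rewrite ger0_norm ?subr_ge0 ?ler_ln // lerBlDr.
suff : y <= expR d * z.
  by rewrite -ler_ln ?posrE ?mulr_gt0 ?expR_gt0 // lnM ?posrE ?expR_gt0 // expRK.
have E0 : 1 <= expR d by rewrite -expR0 ler_expR.
have EE : expR d * expR (- d) = 1 by rewrite -expRD subrr expR0.
have F0 := expR_gt0 (- d).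
move: (expR d) (expR (- d)) E0 EE F0 le_yz => E F E0 EE F0 le_yz.
rewrite leNgt; apply/negP => lt_Ez.
have F1 : F <= 1 by nra.
have lt_Fz : F * z < y by nra.
have : 0 < (y - E * z) * (y - F * z) by rewrite mulr_gt0 ?subr_gt0.
have -> : (y - E * z) * (y - F * z) =
  (y - z) ^+ 2 - y * z * (E + F - 2) + (E * F - 1) * z ^+ 2 by ring.
by rewrite EE; lra.
Qed.

(* [y] and [z] lie in the strip [m <= y < 4 m], [D] is the square of
   [2 sinh (d / 2)], and [w] is the horizontal offset in units of cells. *)
Lemma strip_offset (R : realType) (D m y z w : R) :
  3 <= D -> 0 < m -> m <= y < 4 * m -> m <= z < 4 * m ->
  D * m ^+ 2 * w ^+ 2 + (y - z) ^+ 2 = y * z * D -> 1 <= `|w| < 4.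
Proof.
move=> D3 m0 /andP[y1 y2] /andP[z1 z2] E.
have Dm : 0 < D * m ^+ 2 by rewrite mulr_gt0 ?exprn_gt0 //; lra.
(* Equality holds at the corner [y = 4 m], [z = m]. Since [3 <= D], at least [D * m ^+ 2] is left
   for the horizontal term. *)
have yz2 : (y - z) ^+ 2 <= 3 * (y * z - m ^+ 2).
  have [zy|/ltW yz] := leP z y; nra.
have yzm : 0 <= y * z - m ^+ 2 by have := sqr_ge0 (y - z); lra.
have w1 : 1 ^+ 2 <= w ^+ 2 by rewrite -(ler_pM2l Dm); nra.
have yz16 : y * z < 16 * m ^+ 2 by nra.
have w4 : w ^+ 2 < 4 ^+ 2.
  rewrite -(ltr_pM2l Dm); have := sqr_ge0 (y - z); nra.
rewrite -(@ler_sqr _ 1) ?nnegrE // -(@ltr_sqr _ `|w|) ?nnegrE //.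
by rewrite real_normK ?num_real // w1 w4.
Qed.

(** Serves to get [3 <= D] for [strip_offset]. The bound comes from [(3 / 2) ^+ 4 = 81 / 16]. *)
Lemma expR_ge5 (R : realType) (d : R) : 2 <= d -> 5 <= expR d.
Proof.
move=> d2; have h : 3 / 2 <= expR (2^-1 : R).
  by apply: le_trans (expR_ge1Dx _); lra.
have e : expR (2^-1 : R) ^+ 4 = expR 2 by rewrite -expRM_natl; congr expR; lra.
have : expR (2 : R) <= expR d by rewrite ler_expR.
apply: le_trans; rewrite -e.
have : (3 / 2 : R) ^+ 4 <= expR (2^-1) ^+ 4.
  by rewrite lerXn2r ?nnegrE ?expR_ge0 //; lra.
by apply: le_trans; lra.
Qed.

Lemma Hcolorable_card (R : realType) (T : finType) (d : R) (c : Hplane R -> T) :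
  (forall p q, Hdist p q = d -> c p <> c q) -> Hcolorable d #|T|.
Proof.
by move=> cP; exists (enum_rank \o c) => p q /cP ncpq /enum_rank_inj.
Qed.

Lemma Hcolorable_strips (R : realType) (d : R) (n : nat) :
  2 <= d -> d / ln 4 <= n%:R -> Hcolorable d (n.+1 * 5).
Proof.
move=> d2 dn; have L0 : 0 < ln (4 : R) by rewrite ln_gt0 //; lra.
pose strip (y : R) := Num.floor (ln y / ln 4).
pose base (k : int) : R := expR (k%:~R * ln 4).
pose D : R := expR d + expR (- d) - 2.
pose cell (p : R * R) := p.1 / (Num.sqrt D * base (strip p.2)).
pose color (p : Hplane R) : 'I_n.+1 * 'I_5 :=
  (residue n (strip (sval p).2), residue 4 (Num.floor (cell (sval p)))).
have D3 : 3 <= D by have := expR_ge5 d2; have := expR_gt0 (- d); rewrite /D; lra.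
have base_gt0 k : 0 < base k by exact: expR_gt0.
have stripP y : 0 < y -> base (strip y) <= y < 4 * base (strip y).
  move=> y0; rewrite /base; apply/andP; split.
    by rewrite -[leRHS]lnK ?posrE // ler_expR -ler_pdivlMr // floor_le.
  rewrite -[ltLHS]lnK ?posrE // -{1}[4]lnK ?posrE // -expRD ltr_expR.
  rewrite -{1}[ln 4]mul1r -mulrDl -ltr_pdivrMr //.
  by have := floorD1_gt (ln y / ln 4); rewrite rmorphD /= addrC.
rewrite -[5%N]card_ord -{1}[n.+1]card_ord -card_prod.
apply: (@Hcolorable_card _ _ _ color) => p q /Hdist_eq; rewrite -/D.
case: p q => [[x y] /= y0] [[x' y'] /= y'0] dE [].
move=> /residue_floor_eq /= [eqk|].
  move=> /residue_floor_eq; rewrite /cell /= /strip -eqk -/(strip y) -mulrBl.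
  set w := (x - x') / _; have := stripP _ y'0; rewrite /strip -eqk -/(strip y).
  have := stripP _ y0; move: (base_gt0 (strip y)).
  set m := base _ in w * => m0 ym y'm.
  have sD : Num.sqrt D ^+ 2 = D by rewrite sqr_sqrtr //; lra.
  have s0 : 0 < Num.sqrt D by rewrite sqrtr_gt0; lra.
  have : D * m ^+ 2 * w ^+ 2 + (y - y') ^+ 2 = y * y' * D.
    rewrite -dE /w; move: (Num.sqrt D) sD s0 => s <- s0.
    by field; rewrite !lt0r_neq0.
  move=> /(strip_offset D3 m0 ym y'm)/andP[w1 w4].
  (* The same cell would give [|w| < 1], distinct cells of the same color [4 < |w|]; both are
     excluded. *)
  case=> [/floor_eq_dist|]; last lra.
  by rewrite -mulrBl -/w; lra.
(* Distinct strips sharing a palette: the heights alone already force a distance above [n * ln 4],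
   hence above [d]. *)
rewrite -mulrBl normrM [X in _ * X]gtr0_norm ?invr_gt0 // => nlt _.
have : d / ln 4 < `|ln y - ln y'| / ln 4 by exact: le_lt_trans nlt.
rewrite ltr_pM2r ?invr_gt0 // ltNge => /negP; apply.
by apply: ln_dist_le => //; [lra|rewrite -/D -dE lerDr sqr_ge0].
Qed.

Theorem mainTheorem3 (R : realType) (d : R) (hd : 2 <= d) :
  (chiH d <= (5 * (Num.ceil (d / ln 4) + 1))%:~R%:E)%E.
Proof.
have L0 : 0 < ln (4 : R) by rewrite ln_gt0 //; lra.
(* The sign lets the integer ceiling serve as the natural number [n] of [Hcolorable_strips]. *)
have c0 : 0 <= Num.ceil (d / ln 4).
  by rewrite -(ler_int R) (le_trans _ (ceil_ge _)) // divr_ge0 ?ltW //; lra.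
have cE : Num.ceil (d / ln 4) = `|Num.ceil (d / ln 4)|%N by rewrite gez0_abs.
apply: ereal_inf_lbound; exists (`|Num.ceil (d / ln 4)|.+1 * 5)%N.
  by apply: Hcolorable_strips; rewrite // -[leRHS]/(_%:Z%:~R) -cE ceil_ge.
by congr EFin; rewrite {2}cE -[LHS]/(_%:Z%:~R); congr _%:~R; lia.
Qed.
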